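(* Let $s,t,v\ge 0$ be integers, not all zero, let $\omega=s+t+v$ and $\kappa=\max(s+v,v+t,s+t)$. For all sufficiently large $n$ (depending on $s,t,v$) and every cache size $H\ge1$, any schedule, on the sequential machine with cache size $H$, of any execution DAG of the symmetry preserving algorithm $\Phi^{(s,t,v)}$ for symmetric tensor contractions of dimension $n$ has vertical communication cost $$Q_\Phi(n,s,t,v,H)\ \ge\ \max\left[\frac{2\binom{n+\omega-1}{\omega}H}{\left(3\binom{\omega}{\kappa}H\right)^{\omega/\kappa}},\ \binom{n+s+v-1}{s+v}+\binom{n+v+t-1}{v+t}+\binom{n+s+t-1}{s+t}\right],$$ and this lower bound is $\Omega\!\left(n^{\omega}/H^{\omega/\kappa-1}+n^{\kappa}\right)$, with constants depending only on $s,t,v$.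
   Context: Bilinear algorithm. A bilinear algorithm is a triple of real matrices $(F^{(A)},F^{(B)},F^{(C)})$ with the same number of columns. On input vectors $a,b$ it computes $c=F^{(C)}\big[((F^{(A)})^{\mathsf T}a)\odot((F^{(B)})^{\mathsf T}b)\big]$, $\odot$ being the entrywise product. Its rank is the number of columns. Tuples. Let $I_n^d=\{(i_1,\dots,i_d)\in\{1,\dots,n\}^d: i_1\le\dots\le i_d\}$, so $|I_n^d|=\binom{n+d-1}{d}$. For a tuple $k$ of length $q+r$, $\bar\chi^q_r(k)$ is the set of all distinct pairs of tuples of lengths $q$ and $r$ obtained by choosing $q$ positions of $k$, listing the entries at these positions in order, and listing the remaining entries in order. For a tuple $k$ of length $d$, $\rho(k)=d!/\prod_i m_i!$ where $m_i$ are the multiplicities of the distinct values of $k$. Symmetry preserving algorithm $\Phi^{(s,t,v)}$. It is an algorithm for the symmetrized contraction over $v$ indices of a symmetric tensor $A$ of order $s+v$ with a symmetric tensor $B$ of order $v+t$ into a symmetric tensor of order $s+t$, all dimensions $n$ (only its leading-order part is considered; lower-order correction terms computable with $O(n^{\omega-1})$ products are excluded). As a bilinear algorithm: rows of $F^{(A)},F^{(B)},F^{(C)}$ are indexed by $I_n^{s+v},I_n^{v+t},I_n^{s+t}$ respectively, columns by $i\in I_n^\omega$. The only nonzeros are: $F^{(A)}_{j,i}=t!/\rho(a')$ if $(j,a')\in\bar\chi^{s+v}_t(i)$ for some tuple $a'$ of length $t$; $F^{(B)}_{l,i}=s!/\rho(b')$ if $(l,b')\in\bar\chi^{v+t}_s(i)$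 for some tuple $b'$ of length $s$; $F^{(C)}_{h,i}=s!\,t!\,\rho(c')$ if $(h,c')\in\bar\chi^{s+t}_v(i)$ for some tuple $c'$ of length $v$. Execution DAG. An execution DAG of a bilinear algorithm is a directed acyclic graph $G=(V,E)$ in which each vertex has in-degree $0$ (an input value, i.e. an entry of $a$ or $b$) or in-degree $2$ (the result of a weighted addition or of a multiplication of its two predecessors). $V$ is a disjoint union $V^{(A)}\cup V^{(B)}\cup V^{(C)}$: vertices of $V^{(A)}$ (resp. $V^{(B)}$) are linear combinations of entries of $a$ (resp. $b$), vertices of $V^{(C)}$ are the computed products and linear combinations of products; $V^{(M)}\subseteq V^{(C)}$ is the set of computed products, one for each column. The outputs (entries of $c$) are vertices of $V^{(C)}$. Edges go within $V^{(A)}$, within $V^{(B)}$ (these compute, by additions, the operands of the products), from $V^{(A)}$ to $V^{(M)}$ and from $V^{(B)}$ to $V^{(M)}$ (each product has exactly one operand from each), and from $V^{(C)}$ to $V^{(C)}\setminus V^{(M)}$ (summations computing the outputs as prescribed by $F^{(C)}$). Sequential machine with cache size $H$. There is an unbounded main memory and a cache holding at most $H$ elements (one element per vertex value). A schedule is a total order of the operations of the execution DAG (compatible with the DAG), interleaved with reads (memory to cache), writes (cache to memory) and discards from cache; an operation requires its operands to be in cache and puts its result in cache. No element is computed more than once. Initially all inputs are in memory and none is in cache; at the end all outputs must have been written to memory. The vertical communication cost $Q$ is the total number of elements read plus the number written. *)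

(* Defs.v *)
From HB Require Import structures.
From mathcomp Require Import all_boot all_order all_algebra.
From mathcomp Require Import reals exp.

Set Implicit Arguments.
Unset Strict Implicit.
Unset Printing Implicit Defensive.

Import Order.TTheory GRing.Theory Num.Theory.

Local Open Scope ring_scope.

Record bilinear_alg (R : realType) (p q m r : nat) := BilinearAlg {
  matA : 'M[R]_(p, r);
  matB : 'M[R]_(q, r);
  matC : 'M[R]_(m, r)
}.

Definition bilinear_eval (R : realType) (p q m r : nat)
    (L : bilinear_alg R p q m r) (a : 'cV[R]_p) (b : 'cV[R]_q) : 'cV[R]_m :=
  matC L *m map2_mx *%R ((matA L)^T *m a) ((matB L)^T *m b).

(* The set I_n^d, with values 0..n-1 instead of 1..n. *)
Definition incr_tuple (n d : nat) : finType :=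
  {k : d.-tuple 'I_n | sorted leq [seq val x | x <- k]}.

(* The mask m marks the chosen positions; q and r are the numbers of chosen and
   of remaining positions, so the set is empty unless size k = q + r. *)
Definition chi (n q r : nat) (k : seq 'I_n) : {set q.-tuple 'I_n * r.-tuple 'I_n} :=
  [set p : q.-tuple 'I_n * r.-tuple 'I_n |
     [exists m : (size k).-tuple bool,
        (mask m k == p.1) && (mask (map negb m) k == p.2)]].

Definition rho (R : realType) (n : nat) (k : seq 'I_n) : R :=
  (size k)`!%:R / (\prod_(x <- undup k) (count_mem x k)`!)%:R.

(* g b when (k, b) belongs to chi q r i, and 0 when there is no such b.  As i is
   nondecreasing, b is determined by k and i (it is the sorted multiset
   difference), so the pick involves no actual choice. *)
Definition chi_coef (R : realType) (n w q r : nat) (g : r.-tuple 'I_n -> R)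
    (k : incr_tuple n q) (i : incr_tuple n w) : R :=
  if [pick b : r.-tuple 'I_n | (val k, b) \in chi q r (val i)] is Some b
  then g b else 0.

Definition Phi (R : realType) (s t v n : nat) :
    bilinear_alg R #|incr_tuple n (s + v)| #|incr_tuple n (v + t)|
                   #|incr_tuple n (s + t)| #|incr_tuple n (s + t + v)| :=
  BilinearAlg
    (\matrix_(j, i) chi_coef (fun a : t.-tuple 'I_n => t`!%:R / rho R a)
                             (enum_val j) (enum_val i))
    (\matrix_(l, i) chi_coef (fun b : s.-tuple 'I_n => s`!%:R / rho R b)
                             (enum_val l) (enum_val i))
    (\matrix_(h, i) chi_coef (fun c : v.-tuple 'I_n => s`!%:R * t`!%:R * rho R c)
                             (enum_val h) (enum_val i)).

(* How a vertex obtains its value: either it is one of n basic values, or it is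
   the weighted addition WSum x y z u = x * (value of y) + z * (value of u).
   The two operands may coincide (a scaling), so the DAG may have double edges:
   otherwise the multiples of a scalar operand needed by Phi when s = v = 0 or
   t = v = 0 could not be formed. *)
Variant lin_op (R : realType) (n : nat) (V : Type) :=
  | Source of 'I_n
  | WSum of R & V & R & V.
Arguments Source {R n V}.
Arguments WSum {R n V}.

(* The sources of VA and VB are the entries of the two inputs; the sources of VC
   are the products, one per column i, whose operands are opndA i, opndB i. *)
Record circuit (R : realType) (p q m r : nat) := Circuit {
  VA : finType;
  VB : finType;
  VC : finType;
  opA : VA -> lin_op R p VA;
  opB : VB -> lin_op R q VB;
  opC : VC -> lin_op R r VC;
  opndA : 'I_r -> VA;
  opndB : 'I_r -> VB;
  out : 'I_m -> VC
}.

Definition vertex (R : realType) (p q m r : nat) (G : circuit R p q m r) : finType :=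
  (VA G + VB G + VC G)%type.

Section Circuit.
Variables (R : realType) (p q m r : nat) (G : circuit R p q m r).

Definition inA (x : VA G) : vertex G := inl (inl x).
Definition inB (x : VB G) : vertex G := inl (inr x).
Definition inC (x : VC G) : vertex G := inr x.

Definition preds (x : vertex G) : seq (vertex G) :=
  match x with
  | inl (inl x) => if opA x is WSum _ y _ z then [:: inA y; inA z] else [::]
  | inl (inr x) => if opB x is WSum _ y _ z then [:: inB y; inB z] else [::]
  | inr x => match opC x with
             | Source i => [:: inA (opndA G i); inB (opndB G i)]
             | WSum _ y _ z => [:: inC y; inC z]
             end
  end.

Definition edge : rel (vertex G) := fun x y => x \in preds y.

Definition acyclic := forall x y : vertex G, edge x y -> ~~ connect edge y x.

Definition is_input (x : vertex G) : bool := preds x == [::].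

End Circuit.

(* f x is the coefficient vector of vertex x over the basic values. *)
Definition coefs_of (R : realType) (n : nat) (V : Type) (op : V -> lin_op R n V)
    (f : V -> 'cV[R]_n) : Prop :=
  forall x, f x = match op x with
                  | Source j => delta_mx j ord0
                  | WSum a y b z => a *: f y + b *: f z
                  end.

Definition one_vertex_per_source (R : realType) (n : nat) (V : Type)
    (op : V -> lin_op R n V) : Prop :=
  forall j : 'I_n, exists! x : V, op x = Source j.

Record execution_dag (R : realType) (p q m r : nat)
    (L : bilinear_alg R p q m r) (G : circuit R p q m r) : Prop := ExecutionDag {
  dag_acyclic : acyclic G;
  dag_entriesA : one_vertex_per_source (@opA _ _ _ _ _ G);
  dag_entriesB : one_vertex_per_source (@opB _ _ _ _ _ G);
  dag_products : one_vertex_per_source (@opC _ _ _ _ _ G);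
  dag_opndA : exists2 f, coefs_of (@opA _ _ _ _ _ G) f &
                forall i, f (opndA G i) = col i (matA L);
  dag_opndB : exists2 f, coefs_of (@opB _ _ _ _ _ G) f &
                forall i, f (opndB G i) = col i (matB L);
  dag_out : exists2 f, coefs_of (@opC _ _ _ _ _ G) f &
              forall h, f (out G h) = (row h (matC L))^T
}.

Variant instr (V : Type) :=
  | Read of V
  | Write of V
  | Discard of V
  | Compute of V.

Definition computed_vertex (V : Type) (o : instr V) : option V :=
  if o is Compute x then Some x else None.

Definition is_transfer (V : Type) (o : instr V) : bool :=
  match o with Read _ | Write _ => true | Discard _ | Compute _ => false end.

Definition comm_cost (V : Type) (S : seq (instr V)) : nat := count (@is_transfer V) S.

Record state (V : finType) := State { cache : {set V}; memory : {set V} }.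

Section Machine.
Variables (R : realType) (p q m r : nat) (G : circuit R p q m r) (H : nat).

Definition exec (o : instr (vertex G)) (z : state (vertex G)) : state (vertex G) :=
  match o with
  | Read x => State (x |: cache z) (memory z)
  | Write x => State (cache z) (x |: memory z)
  | Discard x => State (cache z :\ x) (memory z)
  | Compute x => State (x |: cache z) (memory z)
  end.

Definition enabled (o : instr (vertex G)) (z : state (vertex G)) : bool :=
  match o with
  | Read x => x \in memory z
  | Write x => x \in cache z
  | Discard x => x \in cache z
  | Compute x => ~~ is_input x && all (fun y => y \in cache z) (preds x)
  end && (#|cache (exec o z)| <= H)%N.

Fixpoint legal (S : seq (instr (vertex G))) (z : state (vertex G)) : bool :=
  if S is o :: S' then enabled o z && legal S' (exec o z) else true.

Definition run (S : seq (instr (vertex G))) (z : state (vertex G)) :=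
  foldl (fun z o => exec o z) z S.

Definition initial : state (vertex G) := State set0 [set x | is_input x].

(* Compatibility with the DAG is enforced by the operand condition in [enabled]. *)
Record schedule (S : seq (instr (vertex G))) : Prop := Schedule {
  sched_legal : legal S initial;
  sched_once : perm_eq (pmap (@computed_vertex (vertex G)) S)
                       (enum [pred x : vertex G | ~~ is_input x]);
  sched_out : forall h, inC (out G h) \in memory (run S initial)
}.

End Machine.

Definition kappa (s t v : nat) : nat := maxn (s + v) (maxn (v + t) (s + t)).

Definition comm_bound (R : realType) (n s t v H : nat) : R :=
  let w := (s + t + v)%N in
  let k := kappa s t v in
  Num.max
    (2 * 'C(n + w - 1, w)%:R * H%:R
       / ((3 * 'C(w, k)%:R * H%:R) `^ (w%:R / k%:R)))
    ('C(n + s + v - 1, s + v)%:R + 'C(n + v + t - 1, v + t)%:R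
       + 'C(n + s + t - 1, s + t)%:R).

(* Main.v *)
(* Cut the schedule into segments computing m products each.  In a segment, the
   operand coefficient vectors of the products computed lie in the span of those
   of the operands in cache at its start or read during it; dually, the columns
   of F^(C) for these products factor through the sums in cache at its end or
   written during it.  So if kappa belongs to F (one of F^(A), F^(B), F^(C)), the
   m columns of F have rank at most H + K, where K is the number of transfers.
   A column has at most C = binom(omega, kappa) nonzeros, so a set W of columns
   of rank rho meets at most C rho rows; these rows include the projections of W
   to all cyclic windows of kappa coordinates, and Shearer's lemma gives
   |W|^kappa <= (C rho)^omega.  Taking m just above E = (3 C H)^(omega/kappa)
   forces K > 2 H; the leftover segment is placed first for F^(A) and F^(B)
   (empty initial cache), last for F^(C) (all outputs finally in memory).
   The second term of the bound holds because the matrices have no zero row in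
   F^(A), F^(B) and no two equal rows in F^(C): each input must be read and the
   outputs are distinct vertices, each of which must be written. *)
Require Import Defs.
From mathcomp Require Import all_boot all_order all_algebra.
From mathcomp Require Import reals exp.
From mathcomp Require Import ring lra zify.

Set Implicit Arguments.
Unset Strict Implicit.
Unset Printing Implicit Defensive.

Import Order.TTheory GRing.Theory Num.Theory.

Local Open Scope ring_scope.

(** * Shearer's lemma *)

(* Hoelder's inequality for #|J| factors, by AM-GM after normalisation. *)
Lemma sum_exp_le_prod_sum (R : realType) (Y I : finType) (J : {set I})
    (k : nat) (c : nat) (b : I -> Y -> nat) (f : Y -> nat) :
  (0 < k)%N -> #|J| = k ->
  (forall y, f y ^ k <= c * \prod_(i in J) b i y)%N ->
  ((\sum_y f y) ^ k <= c * \prod_(i in J) \sum_y b i y)%N.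
Proof.
move=> k_gt0 cardJ f_le; set P := (c * _)%N.
have [P0|P_gt0] := posnP P.
  rewrite P0 leqn0 expn_eq0 k_gt0 andbT sum_nat_eq0; apply/forallP => y /=.
  suff: (f y ^ k == 0)%N by rewrite expn_eq0 => /andP[].
  rewrite -leqn0 -P0; apply: leq_trans (f_le y) _.
  rewrite leq_mul2l; apply/orP; right.
  apply: leq_prod => i _.
  by rewrite (bigD1 y) //= leq_addr.
set B := fun i => (\sum_y b i y)%N.
have B_gt0 i : i \in J -> (0 < B i)%N.
  move=> iJ; rewrite lt0n; apply: contraTN P_gt0 => /eqP Bi0.
  by rewrite /P (bigD1 i) //= -/(B i) Bi0 mul0n muln0.
(* [z] is the [k]-th root of the right-hand side; AM-GM then bounds [f y / z] by the mean of the [k]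
   ratios [b i y / B i]. *)
pose z : R := P%:R `^ k%:R^-1.
have zk : z ^+ k = P%:R.
  rewrite -powR_mulrn ?powR_ge0 // -powRrM mulVf ?powRr1 //.
  by rewrite pnatr_eq0 -lt0n.
have z_gt0 : 0 < z by rewrite powR_gt0 // ltr0n.
have f_bound y : (f y)%:R / z <= (\sum_(i in J) (b i y)%:R / (B i)%:R) / k%:R.
  have AM_ge0 : 0 <= (\sum_(i in J) (b i y)%:R / (B i)%:R) / k%:R :> R.
    by rewrite divr_ge0 // sumr_ge0 // => i _; rewrite divr_ge0.
  rewrite -(@ler_pXn2r _ k) ?nnegrE ?(divr_ge0 _ (ltW z_gt0)) //.
  have := @leif_AGM R I (mem J) (fun i => (b i y)%:R / (B i)%:R).
  rewrite cardJ => /(_ (fun i _ => divr_ge0 (ler0n _ _) (ler0n _ _))) [AGM _].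
  apply: le_trans AGM; rewrite expr_div_n zk ler_pdivrMr ?ltr0n //.
  rewrite prodf_div mulrAC ler_pdivlMr; last first.
    by rewrite prodr_gt0 // => i iJ; rewrite ltr0n B_gt0.
  rewrite -!natr_prod -natrX -!natrM ler_nat /P mulnA [(_ * c)%N]mulnC.
  by rewrite leq_mul // f_le.
rewrite -(ler_nat R) natrX -zk ler_pXn2r ?nnegrE ?(ltW z_gt0) //.
rewrite -[leRHS]mul1r -ler_pdivrMr // natr_sum mulr_suml.
(* Summed over [y], the ratios for each [i] add up to 1, so the mean sums to 1. *)
apply: le_trans (ler_sum _ (fun y _ => f_bound y)) _.
rewrite -mulr_suml exchange_big /= ler_pdivrMr ?ltr0n // mul1r.
rewrite -cardJ -sum1_card natr_sum; apply: ler_sum => i iJ.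
rewrite -mulr_suml -natr_sum -/(B i) divff // pnatr_eq0 -lt0n.
exact: B_gt0.
Qed.

Lemma card_by_label (X A : finType) (W : {set X}) (x : X -> A) :
  (\sum_a #|[set w in W | x w == a]| = #|W|)%N.
Proof.
rewrite -sum1_card (partition_big x xpredT) //=.
by apply: eq_bigr => a _; rewrite -sum1_card; apply: eq_bigl => w; rewrite inE.
Qed.

(** Since [p] determines [x], slices with different labels have disjoint images. *)
Lemma sum_card_slices (X A U : finType) (W : {set X}) (x : X -> A) (p : X -> U) :
  (forall w w', p w = p w' -> x w = x w') ->
  (\sum_a #|p @: [set w in W | x w == a]| <= #|p @: W|)%N.
Proof.
move=> det.
have [->|[w0 _]] := set_0Vmem W.
  rewrite big1 // => a _; apply/eqP; rewrite cards_eq0; apply/eqP/setP => u.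
  by rewrite inE; apply/imsetP => -[w]; rewrite !inE.
(* [lab] recovers the label from a value of [p]; the default [x w0] is reached only outside the
   image of [W]. *)
pose lab u := if [pick w in W | p w == u] is Some w then x w else x w0.
have labE w : w \in W -> lab (p w) = x w.
  move=> wW; rewrite /lab; case: pickP => [w' /andP[_ /eqP/det -> //]|].
  by move/(_ w); rewrite wW eqxx.
rewrite -(card_by_label (p @: W) lab); apply: leq_sum => a _.
apply/subset_leq_card/subsetP => u /imsetP[w]; rewrite !inE => /andP[wW /eqP xw] ->.
by rewrite imset_f // labE // xw eqxx.
Qed.

(* Shearer's lemma (the uniform-cover form of the Loomis-Whitney inequality),
   by induction on the set D of coordinates on which points of W may differ. *)
Lemma shearer (R : realType) (X A U I J : finType) (k : nat) (x : X -> J -> A)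
    (p : I -> X -> U) (cov : I -> {set J}) (W : {set X}) :
  (0 < k)%N ->
  (forall w w', x w =1 x w' -> w = w') ->
  (forall i w w' j, p i w = p i w' -> j \in cov i -> x w j = x w' j) ->
  (forall j, #|[set i | j \in cov i]| = k) ->
  (#|W| ^ k <= \prod_i #|p i @: W|)%N.
Proof.
move=> k_gt0 x_inj p_det card_cov.
suff IH (D : {set J}) : forall V : {set X},
    (forall w w' j, w \in V -> w' \in V -> j \notin D -> x w j = x w' j) ->
    (#|V| ^ k <= \prod_i #|p i @: V|)%N.
  by apply: (IH setT) => w w' j _ _; rewrite inE.
have [m] := ubnP #|D|; elim: m D => // m IHm D leDm V agree.
have [D0|[j0 j0D]] := set_0Vmem D.
  have [->|[w wV]] := set_0Vmem V; first by rewrite cards0 exp0n.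
  have -> : V = [set w].
    apply/setP => w'; rewrite inE; apply/idP/eqP => [w'V|-> //].
    by apply: x_inj => j; apply: agree; rewrite // D0 inE.
  rewrite cards1 exp1n; apply: prodn_gt0 => i.
  by rewrite card_gt0; apply/set0Pn; exists (p i w); rewrite imset_f ?set11.
(* [V] is sliced by coordinate [j0]. A factor outside [C] is bounded on each slice by its value on
   [V]; those in [C], exactly [k] of them, are summed by Hoelder's inequality, their projections
   separating the slices. *)
pose C := [set i | j0 \in cov i].
rewrite (bigID (mem C)) /= mulnC -(card_by_label V (fun w => x w j0)).
have Hol : forall a : A, (#|[set w in V | x w j0 == a]| ^ k <=
    (\prod_(i | i \notin C) #|p i @: V|) *
    \prod_(i in C) #|p i @: [set w in V | x w j0 == a]|)%N.
  move=> a; set Va := [set _ in _ | _].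
  have sub : Va \subset V by apply/subsetP => w; rewrite inE => /andP[].
  apply: leq_trans (IHm (D :\ j0) _ Va _) _.
  - by move: leDm; rewrite (cardsD1 j0) j0D.
  - move=> w w' j; rewrite !inE => /andP[wV /eqP wa] /andP[w'V /eqP w'a].
    rewrite negb_and negbK => /orP[/eqP->|jD]; first by rewrite wa w'a.
    exact: agree.
  - rewrite (bigID (mem C)) /= mulnC leq_mul2r; apply/orP; right.
    by apply: leq_prod => i _; rewrite subset_leq_card // imsetS.
apply: leq_trans (sum_exp_le_prod_sum R k_gt0 (card_cov j0) Hol) _.
rewrite leq_mul2l; apply/orP; right; apply: leq_prod => i.
rewrite inE => iC; apply: sum_card_slices => w w' e.
exact: p_det e iC.
Qed.

(** * Expansion of the matrices of Phi *)

(** Every row is a combination of the rows selected by [maxrankfun M], so a nonzero column is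
    already nonzero in one of these [\rank M] rows. *)
Lemma card_support_le_rank (F : fieldType) (m n c : nat) (M : 'M[F]_(m, n)) :
  (forall i, #|[set j | M i j != 0%R]| <= c)%N ->
  (#|[set j | [exists i, M i j != 0%R]]| <= c * \rank M)%N.
Proof.
move=> row_le; pose f := maxrankfun M.
have sub : [set j | [exists i, M i j != 0]] \subset
    \bigcup_(k : 'I_(\rank M)) [set j | M (f k) j != 0].
  apply/subsetP => j; rewrite inE => /existsP[i Mij].
  have /submxP[D DM] : (row i M <= rowsub f M)%MS by rewrite eq_maxrowsub row_sub.
  apply/bigcupP; have [k /= Mkj|none] := pickP (fun k => M (f k) j != 0).
    by exists k; rewrite ?inE.
  case/eqP: Mij; have /matrixP/(_ 0 j) := DM; rewrite !mxE => ->.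
  rewrite big1 // => k _; rewrite mxE.
  by have /negbFE/eqP -> := none k; rewrite mulr0.
apply: leq_trans (subset_leq_card sub) _.
rewrite mulnC -[X in (X * _)%N]card_ord -sum_nat_const.
elim/big_rec2: _ => [|k b A _ leA]; first by rewrite cards0.
by rewrite (leq_trans (leq_card_setU _ _)) // leq_add.
Qed.

(** Choices of positions are encoded as sets, so that they can be counted by binomial coefficients
    and specialised to windows. *)
Definition set_mask (w : nat) (D : {set 'I_w}) : bitseq :=
  [seq j \in D | j <- enum 'I_w].

Lemma size_set_mask (w : nat) (D : {set 'I_w}) : size (set_mask D) = w.
Proof. by rewrite size_map size_enum_ord. Qed.

Lemma count_set_mask (w : nat) (D : {set 'I_w}) : count id (set_mask D) = #|D|.
Proof.
by rewrite count_map -sum1_count big_enum_cond -sum1_card; apply: eq_bigl => j.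
Qed.

Lemma set_maskP (w : nat) (m : bitseq) :
  size m = w -> exists D : {set 'I_w}, m = set_mask D.
Proof.
move=> sz_m; exists [set j : 'I_w | nth false m j].
apply: (@eq_from_nth _ false) => [|k]; rewrite ?size_set_mask // sz_m => ltkw.
have -> : k = nat_of_ord (Ordinal ltkw) by [].
by rewrite (nth_map (Ordinal ltkw)) ?size_enum_ord // nth_ord_enum inE.
Qed.

(** The complement of a mask selecting [k] yields a tuple of length [r], so the pick in [chi_coef]
    succeeds as soon as [k] can be selected from [i]. *)
Lemma chi_coef_neq0 (R : realType) (n w q r : nat) (g : r.-tuple 'I_n -> R)
    (k : incr_tuple n q) (i : incr_tuple n w) :
  w = (q + r)%N -> (forall b, g b != 0) ->
  (chi_coef g k i != 0) <-> 
  (exists D : {set 'I_w}, mask (set_mask D) (val (val i)) = val (val k)).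
Proof.
move=> wE g_neq0; have sz_i := size_tuple (val i).
have sz_k := size_tuple (val k).
rewrite /chi_coef; case: pickP => [b bP|none]; split=> //.
- move: bP; rewrite inE => /existsP[m /andP[/eqP mk _]] _.
  have [D DE] : exists D : {set 'I_w}, (m : bitseq) = set_mask D.
    by apply: set_maskP; rewrite size_tuple sz_i.
  by exists D; rewrite -DE.
- by rewrite eqxx.
- case=> D Dk.
  have sz_m : size (set_mask D) == size (val (val i)) by rewrite size_set_mask sz_i.
  have sz_b : size (mask (map negb (set_mask D)) (val (val i))) == r.
    rewrite size_mask ?(size_map negb) ?(eqP sz_m) //.
    rewrite count_map.
    have := count_predC id (set_mask D).
    rewrite -(size_mask (eqP sz_m)) Dk sz_k size_set_mask [RHS]wE.
    by move/addnI/eqP.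
  have := none (Tuple sz_b); rewrite inE => /existsP[].
  by exists (Tuple sz_m); rewrite /= Dk !eqxx.
Qed.

(** Sending [k] to a set of positions that selects it is injective on the support, and such a set
    has [q] elements. *)
Lemma card_supp_chi_coef (R : realType) (n w q r : nat) (g : r.-tuple 'I_n -> R)
    (i : incr_tuple n w) :
  w = (q + r)%N -> (forall b, g b != 0) ->
  (#|[set k : incr_tuple n q | chi_coef g k i != 0%R]| <= 'C(w, q))%N.
Proof.
move=> wE g_neq0; rewrite -[w in 'C(w, _)]card_ord -card_draws.
pose f (k : incr_tuple n q) : {set 'I_w} :=
  odflt set0 [pick D | mask (set_mask D) (val (val i)) == val (val k)].
have fE k : chi_coef g k i != 0 -> mask (set_mask (f k)) (val (val i)) = val (val k).
  move/(chi_coef_neq0 k i wE g_neq0) => [D Dk]; rewrite /f.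
  by case: pickP => [E /eqP //|/(_ D)]; rewrite Dk eqxx.
rewrite -(card_in_imset (f := f)).
  apply/subset_leq_card/subsetP => D /imsetP[k]; rewrite !inE => /fE fk ->.
  rewrite -count_set_mask -(size_mask (s := val (val i))) ?size_set_mask
          ?fk ?size_tuple ?card_ord //.
move=> k k'; rewrite !inE => /fE fk /fE fk' ff.
by apply/val_inj/val_inj; rewrite -fk -fk' ff.
Qed.

Lemma card_ord_lt (w q : nat) : (q <= w)%N -> #|[set j : 'I_w | (j < q)%N]| = q.
Proof.
move=> leqw; have inj : injective (widen_ord leqw).
  by move=> a b /(congr1 val) /= /val_inj.
rewrite -[RHS]card_ord -(card_imset _ inj); 
apply: eq_card => j; rewrite !inE; apply/idP/imsetP => [ltjq|[x _ ->]].
  by exists (Ordinal ltjq) => //; apply: val_inj.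
exact: (ltn_ord x).
Qed.

(** The [q] cyclically consecutive positions from [i] on: the subtraction is modulo [w.+1]. *)
Definition window (w q : nat) (i : 'I_w.+1) : {set 'I_w.+1} :=
  [set j : 'I_w.+1 | (val (j - i)%R < q)%N].

Lemma card_window (w q : nat) (i : 'I_w.+1) : (q <= w.+1)%N -> #|window q i| = q.
Proof.
move=> leq; rewrite -[RHS](card_ord_lt leq) -[LHS](card_imset _ (addIr (- i))).
apply: eq_card => j; rewrite !inE; apply/imsetP/idP => [[k]|ltj].
  by rewrite inE => ltk ->.
by exists (j + i); rewrite ?addrK // inE addrK.
Qed.

(** The reflection sending [i] to [j - i] maps the windows through [j] onto the residues below [q].
    This is the uniform cover that [shearer] requires. *)
Lemma card_window_cover (w q : nat) (j : 'I_w.+1) :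
  (q <= w.+1)%N -> #|[set i | j \in window q i]| = q.
Proof.
move=> leq; rewrite -[RHS](card_ord_lt leq).
have sub_inj : injective (fun i => j - i) by move=> i i' /addrI/oppr_inj.
rewrite -[LHS](card_imset _ sub_inj).
apply: eq_card => k; rewrite !inE; apply/imsetP/idP => [[i]|ltk].
  by rewrite !inE => lti ->.
by exists (j - k); rewrite ?inE opprB addrCA subrr addr0.
Qed.

Lemma mask_eq_nth (T : Type) (x0 : T) (m : bitseq) (s s' : seq T) (j : nat) :
  size s = size s' -> mask m s = mask m s' -> nth false m j ->
  (j < size s)%N -> nth x0 s j = nth x0 s' j.
Proof.
elim: m s s' j => [|b m IHm] [|x s] [|x' s'] [|j] //= [sz].
  by move=> + b1; rewrite b1 => -[].
by case: b => [[_ e]|e]; apply: IHm.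
Qed.

Lemma incr_tuple_mask (n w q : nat) (i : incr_tuple n w) (D : {set 'I_w}) :
  #|D| = q -> exists k : incr_tuple n q, val (val k) = mask (set_mask D) (val (val i)).
Proof.
move=> cardD.
have sz : size (mask (set_mask D) (val (val i))) == q.
  by rewrite size_mask ?count_set_mask ?cardD // size_set_mask size_tuple.
have srt : sorted leq [seq val x | x <- Tuple sz].
  by rewrite /= map_mask sorted_mask ?(valP i) //; apply: leq_trans.
by exists (exist _ (Tuple sz) srt).
Qed.

(** Transposed, so that products index the rows; columns of [F] outside [W] are zeroed rather than
    deleted, which keeps the dimensions independent of [W]. *)
Definition col_restrict (R : realType) (p r : nat) (F : 'M[R]_(p, r))
    (W : {set 'I_r}) : 'M[R]_(r, p) :=
  \matrix_(i, j) if i \in W then F j i else 0.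

(** Shearer's lemma is applied to the tuples of [W] and their projections to the [w] cyclic windows.
    Every projection indexes a row met by [W], and [card_support_le_rank] bounds the number of these
    rows. *)
Lemma chi_expansion (R : realType) (n w q r : nat) (g : r.-tuple 'I_n -> R)
    (W : {set 'I_#|incr_tuple n w|}) :
  w = (q + r)%N -> (0 < q)%N -> (forall b, g b != 0) ->
  (#|W| ^ q <=
    ('C(w, q) * \rank (col_restrict
      (\matrix_(k < #|incr_tuple n q|, i < #|incr_tuple n w|)
         chi_coef g (enum_val k) (enum_val i)) W)) ^ w)%N.
Proof.
move=> wE q_gt0 g_neq0; have leqw : (q <= w)%N by rewrite wE leq_addr.
(* Cyclic arithmetic on positions needs a successor; [w = 0] contradicts [0 < q <= w]. *)
case: w W wE leqw => [|w] W wE leqw; first by rewrite leqNgt q_gt0 in leqw.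
set F := (\matrix_(_, _) _); set M := col_restrict F W.
(* [sub (a, c)] is the row index of the restriction of tuple [c] to window [a]. *)
have /fin_all_exists[sub subE] : forall ci : 'I_w.+1 * 'I_#|incr_tuple n w.+1|,
    exists k : 'I_#|incr_tuple n q|, val (val (enum_val k)) =
      mask (set_mask (window q ci.1)) (val (val (enum_val ci.2))).
  move=> [a c]; have [k kE] := incr_tuple_mask (enum_val c) (card_window a leqw).
  by exists (enum_rank k); rewrite enum_rankK.
pose x (c : 'I_#|incr_tuple n w.+1|) j := tnth (val (enum_val c)) j.
have le_supp : (#|[set k | [exists c, M c k != 0%R]]| <= 'C(w.+1, q) * \rank M)%N.
  apply: card_support_le_rank => c.
  have [cW|cW] := boolP (c \in W); last first.
    apply: leq_trans (leq0n _); rewrite leqn0 cards_eq0; apply/eqP/setP => k.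
    by rewrite !inE mxE (negbTE cW) eqxx.
  apply: leq_trans (card_supp_chi_coef (enum_val c) wE g_neq0).
  rewrite -(card_imset _ enum_val_inj); apply/subset_leq_card/subsetP => y /imsetP[k].
  by rewrite !inE mxE cW mxE => + ->.
rewrite -(leq_exp2r _ _ (ltn0Sn w)) in le_supp; apply: leq_trans le_supp.
apply: leq_trans (shearer R (x := x) (p := fun a c => sub (a, c))
                          (cov := @window w q) W q_gt0 _ _ _) _.
- move=> c c' xx; apply/enum_val_inj/val_inj/eq_from_tnth => j; exact: xx.
- move=> a c c' j e jwin; have nth_win : nth false (set_mask (window q a)) j.
    by rewrite (nth_map j) ?size_enum_ord // nth_ord_enum.
  have mask_eq := subE (a, c); rewrite [sub _]e (subE (a, c')) in mask_eq.
  have x0 := x c j; rewrite /x !(tnth_nth x0).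
  by apply: (mask_eq_nth x0 _ (esym mask_eq) nth_win); rewrite !size_tuple.
- by move=> j; apply: card_window_cover.
rewrite -[X in (_ <= _ ^ X)%N](card_ord w.+1) -prod_nat_const.
apply: leq_prod => a _; apply/subset_leq_card/subsetP => k /imsetP[c cW ->].
rewrite inE; apply/existsP; exists c; rewrite mxE cW mxE.
apply/(chi_coef_neq0 _ _ wE g_neq0).
by exists (window q a); rewrite subE.
Qed.

(** * Zero and equal rows of the matrices of [Phi] *)

Lemma chi_coef_subseq (R : realType) (n w q r : nat) (g : r.-tuple 'I_n -> R)
    (k : incr_tuple n q) (i : incr_tuple n w) :
  w = (q + r)%N -> (forall b, g b != 0) ->
  (chi_coef g k i != 0) = subseq (val (val k)) (val (val i)).
Proof.
move=> wE g_neq0; apply/idP/subseqP => [/(chi_coef_neq0 k i wE g_neq0)[D <-]|[m sz_m kE]].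
  by exists (set_mask D); rewrite ?size_set_mask ?size_tuple.
apply/(chi_coef_neq0 k i wE g_neq0).
have [|D DE] := @set_maskP w m; first by rewrite sz_m size_tuple.
by exists D; rewrite -DE.
Qed.

Lemma incr_tuple_sorted (n d : nat) (k : incr_tuple n d) :
  sorted (relpre val leq) (val (val k)).
Proof. by rewrite -sorted_map; apply: (valP k). Qed.

(** Sorting preserves subsequences, and [k], a prefix of the concatenation, is already sorted. *)
Lemma incr_tuple_merge (n w q r : nat) (k : incr_tuple n q) (b : r.-tuple 'I_n) :
  w = (q + r)%N -> exists i : incr_tuple n w,
    subseq (val (val k)) (val (val i)) /\ perm_eq (val (val i)) (val (val k) ++ b).
Proof.
move=> wE; pose le : rel 'I_n := relpre val leq.
have le_total : total le by move=> x y; apply: leq_total.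
have le_trans : transitive le by move=> x y z; apply: leq_trans.
have sz : size (sort le (val (val k) ++ b)) == w.
  by rewrite size_sort size_cat !size_tuple wE.
have srt : sorted leq [seq val x | x <- Tuple sz].
  by rewrite /= sorted_map sort_sorted.
exists (exist _ (Tuple sz) srt); split; last by rewrite /= perm_sort.
rewrite /= -[X in subseq X _](sorted_sort le_trans); last exact: incr_tuple_sorted.
exact: (subseq_sort le_total le_trans (prefix_subseq _ _)).
Qed.

Lemma card_incr_tuple (n d : nat) :
  (0 < n)%N -> #|incr_tuple n d| = 'C(n + d - 1, d).
Proof.
case: n => // n _; rewrite card_sig addSn subn1 /= [(n + d)%N]addnC.
rewrite -card_sorted_tuples; apply: eq_card => t.
by rewrite !inE.
Qed.

Lemma chi_row_neq0 (R : realType) (n w q r : nat) (g : r.-tuple 'I_n -> R)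
    (k : incr_tuple n q) :
  (0 < n)%N -> w = (q + r)%N -> (forall b, g b != 0) ->
  exists i : incr_tuple n w, chi_coef g k i != 0.
Proof.
move=> n_gt0 wE g_neq0.
have [i [sub _]] := incr_tuple_merge k (nseq_tuple r (Ordinal n_gt0)) wE.
by exists i; rewrite chi_coef_subseq.
Qed.

(** Nondecreasing tuples amount to multisets: if no multiplicity were larger in [k'], then [k']
    would be contained in [k], and equal to it by size. *)
Lemma incr_tuple_count_lt (n q : nat) (k k' : incr_tuple n q) :
  k != k' -> exists x, (count_mem x (val (val k)) < count_mem x (val (val k')))%N.
Proof.
move=> neq; apply/existsP; apply: contraNT neq => /existsPn no_lt.
have /count_subseqP[s sub_s perm_s] :
    forall x, (count_mem x (val (val k')) <= count_mem x (val (val k)))%N.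
  by move=> x; rewrite leqNgt; apply: no_lt.
have sE : s = val (val k).
  apply/eqP; rewrite -(size_subseq_leqif sub_s) -(perm_size perm_s).
  by rewrite !size_tuple.
apply/eqP/val_inj/val_inj; rewrite -sE in perm_s *.
apply: (@sorted_eq _ (relpre val leq)).
- by move=> x y z; apply: leq_trans.
- by move=> x y; rewrite -eqn_leq => /eqP/val_inj.
- by rewrite sE incr_tuple_sorted.
- exact: incr_tuple_sorted.
- by rewrite perm_sym.
Qed.

(** Some [x] is more frequent in [k'] and some [y] in [k]. Padding [k] with copies of [y] gives an
    [i] with too few [x] to contain [k']. *)
Lemma chi_rows_neq (R : realType) (n w q r : nat) (g : r.-tuple 'I_n -> R)
    (k k' : incr_tuple n q) :
  w = (q + r)%N -> (forall b, g b != 0) -> k != k' ->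
  exists2 i : incr_tuple n w, chi_coef g k i != 0 & chi_coef g k' i = 0.
Proof.
move=> wE g_neq0 neq.
have [x lt_x] := incr_tuple_count_lt neq.
have [y lt_y] : exists y, (count_mem y (val (val k')) < count_mem y (val (val k)))%N.
  by apply: incr_tuple_count_lt; rewrite eq_sym.
have neq_yx : (y == x) = false.
  by apply: contraTF lt_x => /eqP <-; rewrite -leqNgt ltnW.
have [i [sub_i perm_i]] := incr_tuple_merge k (nseq_tuple r y) wE.
exists i; first by rewrite chi_coef_subseq.
apply/eqP; rewrite -[_ == _]negbK chi_coef_subseq //; apply/negP => sub_i'.
have : (count_mem x (val (val k')) <= count_mem x (val (val i)))%N.
  exact: leq_count_subseq.
rewrite (permP perm_i) count_cat count_nseq /= neq_yx mul0n addn0.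
by rewrite leqNgt lt_x.
Qed.

(** * Executions *)

Section Machine.
Variables (R : realType) (p q m r : nat) (G : circuit R p q m r) (H : nat).
Implicit Types (S : seq (instr (vertex G))) (z : state (vertex G)) (x : vertex G).

Definition computed S : seq (vertex G) := pmap (@computed_vertex (vertex G)) S.
Definition reads S : seq (vertex G) :=
  pmap (fun o => if o is Read x then Some x else None) S.
Definition writes S : seq (vertex G) :=
  pmap (fun o => if o is Write x then Some x else None) S.

Lemma comm_cost_reads_writes S : comm_cost S = (size (reads S) + size (writes S))%N.
Proof. by elim: S => //= -[] x S; rewrite /comm_cost /= => ->; rewrite ?addnS. Qed.

Lemma legal_cat S S' z :
  legal H (S ++ S') z = legal H S z && legal H S' (run S z).
Proof. by elim: S z => //= o S IHS z; rewrite IHS andbA. Qed.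

Lemma run_cat S S' z : run (S ++ S') z = run S' (run S z).
Proof. exact: foldl_cat. Qed.

Lemma card_cache_run S z :
  legal H S z -> (#|cache z| <= H)%N -> (#|cache (run S z)| <= H)%N.
Proof.
by elim: S z => //= o S IHS z /andP[/andP[_ le_o] leg] _; apply: IHS.
Qed.

Lemma memory_run S z x :
  x \in memory (run S z) -> x \in memory z \/ x \in writes S.
Proof.
elim: S z => [|o S IHS] z /=; first by left.
move=> /IHS; case: o => y //= [/setU1P[->|]|xS].
- by right; rewrite inE eqxx.
- by left.
- by right; rewrite inE xS orbT.
Qed.

(** Elements enter the cache only by a read or a computation, and what is written comes from the
    cache; so, of the initial memory, only the elements read need [P]. *)
Lemma run_invariant (P : vertex G -> Prop) S z :
  legal H S z ->
  (forall x, x \in cache z -> P x) ->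
  (forall x, x \in memory z -> x \in reads S -> P x) ->
  (forall x, x \in computed S -> ~~ is_input x ->
     (forall y, y \in preds x -> P y) -> P x) ->
  [/\ forall x, x \in computed S -> P x,
      forall x, x \in cache (run S z) -> P x &
      forall x, x \in memory (run S z) -> x \in memory z \/ P x].
Proof.
elim: S z => [|o S IHS] z /=; first by move=> _ Pc _ _; split=> // x; left.
case: o => y /= /andP[/andP[en _] leg] Pc Pm Pcomp.
- have [x|x xm xS|//|//] := IHS _ leg.
    by move=> /setU1P[->|/Pc //]; apply: Pm; rewrite ?inE ?eqxx.
  by apply: Pm; rewrite ?inE ?xS ?orbT.
- have Py := Pc _ en.
  have [//|x|//|comp_P cache_P mem_P] := IHS _ leg.
    by move=> /setU1P[-> //|]; apply: Pm.
  split=> // x /mem_P[|]; last by right.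
  by move=> /setU1P[->|]; [right|left].
- have [x|//|//|//] := IHS _ leg.
  by rewrite !inE => /andP[_ /Pc].
- have /andP[nin /allP pre] := en.
  have Py : P y by apply: Pcomp; rewrite ?inE ?eqxx // => u /pre/Pc.
  have [x|//|x xS|comp_P cache_P mem_P] := IHS _ leg.
  + by move=> /setU1P[->|/Pc].
  + by apply: Pcomp; rewrite inE xS orbT.
  split=> // x; rewrite inE => /predU1P[->//|]; exact: comp_P.
Qed.

(** * Ranks of coefficient vectors along a run *)

Variables (d : nat) (g : vertex G -> 'rV[R]_d).

Definition span_of (K : seq (vertex G)) : 'M[R]_d := (\sum_(x <- K) <<g x>>)%MS.

Lemma rank_span_of K : (\rank (span_of K) <= size K)%N.
Proof.
rewrite /span_of; elim: K => [|x K IHK]; first by rewrite big_nil mxrank0.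
rewrite big_cons (leq_trans (mxrank_adds_leqif _ _)) //= -[(size K).+1]add1n leq_add //.
by rewrite genmxE rank_leq_row.
Qed.

Lemma mem_span_of K x : x \in K -> (g x <= span_of K)%MS.
Proof.
elim: K => // y K IHK; rewrite inE /span_of big_cons => /predU1P[<-|/IHK le_x].
  by rewrite (submx_trans _ (addsmxSl _ _)) // genmxE.
exact: submx_trans le_x (addsmxSr _ _).
Qed.

(** Membership in the span of the predecessors, phrased over all [U] to match the closure hypothesis
    of [run_invariant]. *)
Definition combines_preds x : Prop :=
  ~~ is_input x -> forall U : 'M[R]_d,
    (forall y, y \in preds x -> (g y <= U)%MS) -> (g x <= U)%MS.

Lemma rank_computed_le_reads S z (n : nat) (M : 'M[R]_(n, d)) :
  legal H S z -> (forall x, combines_preds x) ->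
  (forall i, row i M = 0 \/ exists2 x, x \in computed S & row i M = g x) ->
  (\rank M <= #|cache z| + size (reads S))%N.
Proof.
move=> leg lin rowM; set K := enum (cache z) ++ reads S.
have [|||comp_le _ _] := run_invariant (P := fun x => (g x <= span_of K)%MS) leg.
- by move=> x xc; apply: mem_span_of; rewrite mem_cat mem_enum xc.
- by move=> x _ xr; apply: mem_span_of; rewrite mem_cat xr orbT.
- by move=> x _ /(lin x)/[apply].
apply: leq_trans (_ : \rank (span_of K) <= _)%N; last first.
  by rewrite (leq_trans (rank_span_of _)) // size_cat -cardE.
apply/mxrankS/row_subP => i.
by have [->|[x /comp_le le_x ->]] := rowM i; rewrite ?sub0mx.
Qed.

(* When S3 is empty the outputs are already in memory, so that the cache left
   by S2 does not count and L can be taken empty. *)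
Lemma rank_outputs_le_writes S1 S2 S3 (L : seq (vertex G)) (n : nat)
    (M : 'M[R]_(n, d)) :
  legal H (S1 ++ S2 ++ S3) (initial G) ->
  (forall x, is_input x -> g x = 0) ->
  (forall x, x \in computed S1 \/ x \in computed S3 -> combines_preds x) ->
  (forall i, exists2 x, x \in memory (run (S1 ++ S2 ++ S3) (initial G)) &
                        row i M = g x) ->
  (S3 = [::] \/ {subset cache (run (S1 ++ S2) (initial G)) <= L}) ->
  (\rank M <= size L + size (writes S2))%N.
Proof.
rewrite !legal_cat !run_cat; set z1 := run S1 _; set z2 := run S2 z1.
move=> /and3P[leg1 leg2 leg3] in0 lin rowM cache2.
have init0 x : x \in memory (initial G) -> (g x <= (0 : 'M[R]_d))%MS.
  by rewrite inE => /in0 ->; apply: sub0mx.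
(* Everything in memory before [S2] has the zero vector, so after [S2] only the elements written
   during it contribute through memory. *)
have [|||_ _ mem1] := run_invariant (P := fun x => (g x <= (0 : 'M[R]_d))%MS) leg1.
- by move=> x; rewrite inE.
- by move=> x /init0.
- by move=> x x1 nin; apply: (lin x _ nin); left.
set K := L ++ writes S2.
have le0 x : (g x <= (0 : 'M[R]_d))%MS -> (g x <= span_of K)%MS.
  by rewrite submx0 => /eqP ->; apply: sub0mx.
have mem2 x : x \in memory z2 -> (g x <= span_of K)%MS.
  case/memory_run => [/mem1[/init0|]|xw]; try exact: le0.
  by apply: mem_span_of; rewrite mem_cat xw orbT.
have mem3 x : x \in memory (run S3 z2) -> (g x <= span_of K)%MS.
  case: cache2 => [->|cacheL]; first exact: mem2.
  have [|||_ _ mem_P] := run_invariant (P := fun x => (g x <= span_of K)%MS) leg3.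
  - by move=> y /cacheL yL; apply: mem_span_of; rewrite mem_cat yL.
  - by move=> y /mem2.
  - by move=> y y3 nin; apply: (lin y _ nin); right.
  by case/mem_P => // /mem2.
apply: leq_trans (_ : \rank (span_of K) <= _)%N; last first.
  by rewrite -size_cat rank_span_of.
apply/mxrankS/row_subP => i.
by have [x /mem3 le_x ->] := rowM i.
Qed.

End Machine.

(** * Segments *)

Lemma count_suffix (T : Type) (p : pred T) (e : nat) (S : seq T) :
  (0 < e)%N -> (e <= count p S)%N ->
  exists S1 S2, S = S1 ++ S2 /\ count p S2 = e.
Proof.
move=> e_gt0; elim: S => [|o S IHS] /=; first by rewrite leqNgt e_gt0.
have [/IHS[S1 [S2 [-> <-]]] _|lt_e le_e] := leqP e (count p S).
  by exists (o :: S1), S2.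
exists [::], (o :: S); split=> //=; apply/eqP; rewrite eqn_leq le_e andbT.
by case: (p o) le_e => //=; rewrite add0n leqNgt lt_e.
Qed.

(** Full segments are cut off from the end, which leaves the incomplete one at the start; in a
    schedule it then begins with an empty cache. *)
Lemma count_segments_prefix (R : realType) (T : Type) (p c : pred T) (e : nat)
    (B : R) (S : seq T) :
  (0 < e)%N ->
  (forall S1 S2 S3, S = S1 ++ S2 ++ S3 -> count p S2 = e ->
     B * e%:R <= (count c S2)%:R) ->
  (forall S1 S2, S = S1 ++ S2 -> (count p S1 < e)%N ->
     B * (count p S1)%:R <= (count c S1)%:R) ->
  B * (count p S)%:R <= (count c S)%:R.
Proof.
move=> e_gt0; have [n] := ubnP (count p S).
elim: n S => // n IHn S lt_n full part.
have [lt_e|le_e] := ltnP (count p S) e; first by apply: (part S [::]); rewrite ?cats0.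
have [S1 [S2 [SE pS2]]] := count_suffix e_gt0 le_e.
rewrite SE !count_cat !natrD mulrDr lerD //.
  apply: IHn => [|U1 U2 U3 UE|U1 U2 UE].
  - by move: lt_n; rewrite SE count_cat pS2 ltnS; apply: leq_trans; rewrite -addn1 leq_add.
  - by apply: (full U1 U2 (U3 ++ S2)); rewrite SE UE !catA.
  - by apply: (part U1 (U2 ++ S2)); rewrite SE UE catA.
by rewrite pS2; apply: (full S1 S2 [::]); rewrite ?cats0.
Qed.

(** Mirror image of [count_segments_prefix] under list reversal, with the incomplete segment
    last. *)
Lemma count_segments_suffix (R : realType) (T : Type) (p c : pred T) (e : nat)
    (B : R) (S : seq T) :
  (0 < e)%N ->
  (forall S1 S2 S3, S = S1 ++ S2 ++ S3 -> count p S2 = e ->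
     B * e%:R <= (count c S2)%:R) ->
  (forall S1 S2, S = S1 ++ S2 -> (count p S2 < e)%N ->
     B * (count p S2)%:R <= (count c S2)%:R) ->
  B * (count p S)%:R <= (count c S)%:R.
Proof.
move=> e_gt0 full part; rewrite -(count_rev p) -(count_rev c).
apply: (count_segments_prefix e_gt0) => [S1 S2 S3 SE pS2|S1 S2 SE].
  rewrite -(count_rev c); apply: (full (rev S3) (rev S2) (rev S1)).
    by rewrite -[S]revK SE !rev_cat catA.
  by rewrite count_rev.
rewrite -(count_rev p) -(count_rev c); apply: (part (rev S2)).
by rewrite -[S]revK SE rev_cat.
Qed.

(* Passing from E to an integer segment length m loses nothing: m > E forces the
   integer H + K to exceed 3 H, and the extra unit absorbs the rounding of m. *)
Lemma full_segment_cost (R : realType) (E : R) (k w c H K m : nat) :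
  (0 < k <= w)%N -> (0 < c)%N -> (0 < H)%N -> 0 < E ->
  E ^+ k = (3 * c%:R * H%:R) ^+ w ->
  E < m%:R <= E + 1 -> (m ^ k <= (c * (H + K)) ^ w)%N ->
  2 * H%:R / E * m%:R <= K%:R.
Proof.
move=> /andP[k_gt0 le_kw] c_gt0 H_gt0 E_gt0 Ek /andP[lt_Em le_mE] le_m.
have H_ge1 : 1 <= H%:R :> R by rewrite ler1n.
have c_ge1 : 1 <= c%:R :> R by rewrite ler1n.
have H2_le : 2 * H%:R <= 3 * c%:R * H%:R :> R.
  by rewrite ler_wpM2r //; lra.
have H2_le_E : 2 * H%:R <= E.
  rewrite -(@ler_pXn2r _ k) ?nnegrE ?(ltW E_gt0) ?mulr_ge0 // Ek.
  apply: (@le_trans _ _ ((3 * c%:R * H%:R) ^+ k)).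
    by rewrite ler_pXn2r ?nnegrE ?mulr_ge0.
  by rewrite ler_weXn2l //; lra.
(* If [K <= 2 H], then [H + K <= 3 H] and [m ^ k <= E ^ k], against [E < m]. *)
have lt_2HK : (2 * H < K)%N.
  rewrite ltnNge; apply/negP => le_K.
  suff : m%:R <= E by rewrite leNgt lt_Em.
  rewrite -(@ler_pXn2r _ k) ?nnegrE ?(ltW E_gt0) // Ek.
  apply: (@le_trans _ _ ((c * (H + K))%:R ^+ w)); first by rewrite -!natrX ler_nat.
  rewrite lerXn2r ?nnegrE ?mulr_ge0 // -!natrM ler_nat.
  by rewrite [(3 * c)%N]mulnC -mulnA leq_mul2l; apply/orP; right; lia.
rewrite mulrAC ler_pdivrMr //.
(* Rounding costs at most [2 H <= E]: [2 H m <= 2 H E + 2 H <= (2 H + 1) E]. *)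
apply: (@le_trans _ _ ((2 * H%:R + 1) * E)); first by nra.
rewrite ler_wpM2r ?(ltW E_gt0) // -natrM natr1 ler_nat.
exact: lt_2HK.
Qed.

(** Let [y = m / E <= 1]. As [k <= w], [(3 c H y) ^ w = E ^ k y ^ w <= E ^ k y ^ k = m ^ k <= (c K)
    ^ w], whence [3 H y <= K]. *)
Lemma partial_segment_cost (R : realType) (E : R) (k w c H K m : nat) :
  (0 < k <= w)%N -> (0 < c)%N -> 0 < E ->
  E ^+ k = (3 * c%:R * H%:R) ^+ w ->
  m%:R <= E -> (m ^ k <= (c * K) ^ w)%N ->
  2 * H%:R / E * m%:R <= K%:R.
Proof.
move=> /andP[k_gt0 le_kw] c_gt0 E_gt0 Ek le_mE le_m.
have w_gt0 : (0 < w)%N by apply: leq_trans k_gt0 le_kw.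
pose y : R := m%:R / E.
have y_ge0 : 0 <= y by rewrite divr_ge0 ?(ltW E_gt0).
have y_le1 : y <= 1 by rewrite ler_pdivrMr // mul1r.
have c_gt0' : 0 < c%:R :> R by rewrite ltr0n.
have : (3 * c%:R * H%:R * y) ^+ w <= (c%:R * K%:R) ^+ w.
  rewrite exprMn -Ek.
  apply: (@le_trans _ _ (E ^+ k * y ^+ k)).
    by rewrite ler_wpM2l ?exprn_ge0 ?(ltW E_gt0) // ler_wiXn2l.
  by rewrite -exprMn mulrC divfK ?gt_eqF // -natrM -!natrX ler_nat.
have lhs_ge0 : 0 <= 3 * c%:R * H%:R * y by rewrite (mulr_ge0 _ y_ge0) ?mulr_ge0.
rewrite ler_pXn2r ?nnegrE ?lhs_ge0 ?mulr_ge0 // => le_cK.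
have : 3 * H%:R * y <= K%:R by rewrite -(ler_pM2l c_gt0'); lra.
have -> : 2 * H%:R / E * m%:R = 2 * (H%:R * y) :> R by rewrite /y; ring.
have : 0 <= H%:R * y by rewrite mulr_ge0.
lra.
Qed.

(** * Products computed in a segment of a schedule *)

Section Products.
Variables (R : realType) (p q m r : nat) (G : circuit R p q m r) (H : nat).
Implicit Types (S : seq (instr (vertex G))) (x : vertex G).

Definition source_of (n : nat) (V : Type) (o : lin_op R n V) : option 'I_n :=
  if o is Source i then Some i else None.

Definition product_of (o : instr (vertex G)) : option 'I_r :=
  if o is Compute (inr y) then source_of (opC y) else None.

Definition products S : seq 'I_r := pmap product_of S.

Lemma products_cat S S' : products (S ++ S') = products S ++ products S'.
Proof. exact: pmap_cat. Qed.

Lemma size_products S : size (products S) = count [eta product_of] S.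
Proof. exact: size_pmap. Qed.

Lemma productsP S i :
  reflect (exists2 y : VC G, opC y = Source i & inC y \in computed S)
          (i \in products S).
Proof.
apply: (iffP idP).
  elim: S => //= o S IHS; have IH' : i \in products S ->
      exists2 y : VC G, opC y = Source i & inC y \in computed (o :: S).
    move=> /IHS[y yi yS]; exists y => //.
    by case: (o) => //= x; rewrite inE yS orbT.
  case: o IH' => [x|x|x|[x|y]] //= IH'; rewrite /products /=.
  case yE: (opC y) IH' => [j|? ? ? ?] //= IH'.
  rewrite inE => /predU1P[->|//]; exists y => //.
  by rewrite inE eqxx.
case=> y yi; elim: S => //= o S IHS.
rewrite /products /=; case: o => [x|x|x|[x|y']] //=.
rewrite inE => /predU1P[[<-]|yS]; first by rewrite yi /= inE eqxx.
by case: (opC y') => [j|? ? ? ?] /=; rewrite ?inE IHS ?orbT.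
Qed.

Lemma inC_not_input (y : VC G) : ~~ is_input (inC y).
Proof. by rewrite /is_input /=; case: (opC y). Qed.

Hypothesis products_once : one_vertex_per_source (@opC _ _ _ _ _ G).
Variables (S : seq (instr (vertex G))) (sched : schedule H S).

Lemma uniq_products : uniq (products S).
Proof.
pose f x : option 'I_r := if x is inr y then source_of (opC y) else None.
have -> : products S = pmap f (computed S).
  by rewrite /products; elim: (S) => // -[x|x|x|[x|y]] S' /= ->.
have /fin_all_exists[pv pvP] := products_once.
have fK : ocancel f (fun i => inC (pv i)).
  case=> // y /=; case yE: (opC y) => [i|] //=.
  by have [_ /(_ y yE) ->] := pvP i.
apply: (pmap_uniq fK); rewrite (perm_uniq (sched_once sched)); exact: enum_uniq.
Qed.

Lemma computed_schedule x : (x \in computed S) = ~~ is_input x.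
Proof. by rewrite (perm_mem (sched_once sched)) mem_enum. Qed.

Lemma size_products_schedule : size (products S) = r.
Proof.
rewrite -[RHS]card_ord -(card_uniqP uniq_products); apply: eq_card => i.
rewrite [RHS]inE; apply/productsP.
have [y [yi _]] := products_once i.
by exists y; rewrite // computed_schedule inC_not_input.
Qed.

Lemma card_products_segment S1 S2 S3 :
  S = S1 ++ S2 ++ S3 -> #|[set i in products S2]| = count [eta product_of] S2.
Proof.
move=> SE; rewrite -size_products cardsE; apply/card_uniqP.
have := uniq_products.
by rewrite SE !products_cat !cat_uniq => /and3P[_ _ /andP[]].
Qed.

Lemma products_outside S1 S2 S3 (y : VC G) i :
  S = S1 ++ S2 ++ S3 -> opC y = Source i ->
  inC y \in computed S1 \/ inC y \in computed S3 -> i \notin products S2.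
Proof.
move=> SE yi; have := uniq_products.
rewrite SE !products_cat !cat_uniq => /and3P[_ no1 /and3P[_ no3 _]] yS.
have mem_prod S' : inC y \in computed S' -> i \in products S'.
  by move=> yS'; apply/productsP; exists y.
apply/negP => i2; case: yS => /mem_prod iS.
  by case/hasP: no1; exists i; rewrite ?mem_cat ?i2.
by case/hasP: no3; exists i.
Qed.

(** The disjunction leaves open which end of the schedule carries the incomplete segment: the start
    for operands, the end for outputs. *)
Lemma cost_from_segments (k w c : nat) (E : R) :
  (0 < k <= w)%N -> (0 < c)%N -> (0 < H)%N -> 0 < E ->
  E ^+ k = (3 * c%:R * H%:R) ^+ w ->
  (forall S1 S2 S3, S = S1 ++ S2 ++ S3 ->
     (#|[set i in products S2]| ^ k <= (c * (H + comm_cost S2)) ^ w)%N) ->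
  (forall S1 S2, S = S1 ++ S2 ->
     (#|[set i in products S1]| ^ k <= (c * comm_cost S1) ^ w)%N) \/
  (forall S1 S2, S = S1 ++ S2 ->
     (#|[set i in products S2]| ^ k <= (c * comm_cost S2) ^ w)%N) ->
  2 * H%:R / E * r%:R <= (comm_cost S)%:R.
Proof.
move=> le_kw c_gt0 H_gt0 E_gt0 Ek full part.
(* The least integer exceeding [E]: thus [E < e <= E + 1], and an incomplete segment has at most [E]
   products. *)
pose e := (Num.truncn E).+1.
have /andP[le_eE lt_Ee] := truncn_itv (ltW E_gt0).
have full' S1 S2 S3 : S = S1 ++ S2 ++ S3 -> count [eta product_of] S2 = e ->
    2 * H%:R / E * e%:R <= (comm_cost S2)%:R.
  move=> SE eE; apply: (full_segment_cost le_kw c_gt0 H_gt0 E_gt0 Ek).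
    by rewrite lt_Ee /e -natr1 lerD2r.
  by rewrite -eE -(card_products_segment SE); apply: full SE.
have partial n K : (n < e)%N -> (n ^ k <= (c * K) ^ w)%N ->
    2 * H%:R / E * n%:R <= K%:R.
  rewrite ltnS => le_n; apply: (partial_segment_cost le_kw c_gt0 E_gt0 Ek).
  by apply: le_trans le_eE; rewrite ler_nat.
have -> : r%:R = (count [eta product_of] S)%:R :> R.
  by rewrite -size_products size_products_schedule.
case: part => part.
  apply: (count_segments_prefix (ltn0Sn _) full') => S1 S2 SE lt_e.
  apply: partial lt_e _.
  by rewrite -(@card_products_segment [::] S1 S2 SE); apply: part SE.
apply: (count_segments_suffix (ltn0Sn _) full') => S1 S2 SE lt_e.
apply: partial lt_e _.
rewrite -(@card_products_segment S1 S2 [::]) ?cats0 //; exact: part SE.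
Qed.

(** * Rank bound and writes for the outputs *)

Section Outputs.
Variables (F : 'M[R]_(m, r)) (f : VC G -> 'cV[R]_r).
Hypothesis coefs_f : coefs_of (@opC _ _ _ _ _ G) f.
Hypothesis out_f : forall h, f (out G h) = (row h F)^T.

Lemma rank_outputs_segment S1 S2 S3 (L : seq (vertex G)) :
  S = S1 ++ S2 ++ S3 ->
  S3 = [::] \/ {subset cache (run (S1 ++ S2) (initial G)) <= L} ->
  (\rank (col_restrict F [set i in products S2]) <= size L + size (writes S2))%N.
Proof.
move=> SE cacheL; set W := [set i in _].
(* Coefficient vectors cut down to the products of [S2]: inputs and the products of [S1] and [S3]
   get zero, and the outputs give the rows of the transposed [col_restrict]. *)
pose g x : 'rV[R]_r :=
  if x is inr y then \row_i (if i \in W then f y i ord0 else 0) else 0.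
rewrite -mxrank_tr.
apply: (@rank_outputs_le_writes _ _ _ _ _ G H _ g S1 S2 S3) cacheL.
- by rewrite -SE; apply: sched_legal sched.
- by case=> [x //|y]; rewrite (negbTE (inC_not_input y)).
- case=> [x|y] yS nin U predU; first by rewrite /g sub0mx.
  have := coefs_f y; case yE: (opC y) predU => [i|a u b v] predU fy.
    suff -> : g (inr y) = 0 by rewrite sub0mx.
    have iW : i \notin W by rewrite inE (products_outside SE yE).
    apply/rowP => j; rewrite !mxE fy !mxE; case: ifP => // jW.
    by case: eqP => // ji; rewrite -ji jW in iW.
  have -> : g (inr y) = a *: g (inC u) + b *: g (inC v).
    by apply/rowP => j; rewrite !mxE fy !mxE; case: ifP => // _; rewrite !mulr0 addr0.
  rewrite addmx_sub // scalemx_sub //; apply: predU.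
    by rewrite /= yE inE eqxx.
  by rewrite /= yE !inE eqxx orbT.
- move=> h; exists (inC (out G h)).
    by rewrite -SE; apply: sched_out sched h.
  by apply/rowP => j; rewrite !mxE out_f !mxE.
Qed.

(** Outputs are not inputs, so they are absent from the initial memory. *)
Lemma outputs_written : injective (out G) -> (m <= size (writes S))%N.
Proof.
move=> out_inj; rewrite -[m in (m <= _)%N]card_ord cardE.
rewrite -(size_map (fun h => inC (out G h))).
apply: uniq_leq_size => [|_ /mapP[h _ ->]].
  by rewrite map_inj_uniq ?enum_uniq // => h h' [/out_inj].
case: (memory_run (sched_out sched h)) => //.
by rewrite inE (negbTE (inC_not_input _)).
Qed.

End Outputs.

(** * Rank bound and reads for the operands, treating both inputs at once through [emb] *)

Section Operands.
Variables (d : nat) (V : finType) (op : V -> lin_op R d V) (opnd : 'I_r -> V).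
Variables (emb : V -> vertex G) (proj : vertex G -> option V).
Hypothesis embK : pcancel emb proj.
Hypothesis projK : ocancel proj emb.
Hypothesis preds_emb : forall x : V,
  preds (emb x) = if op x is WSum _ y _ z then [:: emb y; emb z] else [::].
Hypothesis proj_inC : forall y, proj (inC y) = None.
Hypothesis preds_product : forall (y : VC G) i,
  opC y = Source i -> emb (opnd i) \in preds (inC y).
Variables (F : 'M[R]_(d, r)) (f : V -> 'cV[R]_d).
Hypothesis coefs_f : coefs_of op f.
Hypothesis opnd_f : forall i, f (opnd i) = col i F.

(* A product vertex is given the coefficients of its operand, so that computing
   it certifies that this operand was in cache. *)
Definition operand_coefs (x : vertex G) : 'rV[R]_d :=
  if proj x is Some y then (f y)^T else
  if x is inr y then if opC y is Source i then (f (opnd i))^T else 0 else 0.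

Lemma operand_coefs_emb y : operand_coefs (emb y) = (f y)^T.
Proof. by rewrite /operand_coefs embK. Qed.

Lemma operand_coefs_product (y : VC G) i :
  opC y = Source i -> operand_coefs (inC y) = (col i F)^T.
Proof. by move=> yi; rewrite /operand_coefs proj_inC /= yi opnd_f. Qed.

(** Sums in the image of [emb] are linear by [coefs_f], a product copies the vector of a
    predecessor, and all remaining non-input vertices have the zero vector. *)
Lemma operand_coefs_combines x : combines_preds operand_coefs x.
Proof.
move=> nin U predU; case px: (proj x) (projK x) => [y|] /= embE; last first.
  rewrite /operand_coefs px; case: x nin predU px embE => [x|y] _ predU _ _.
    exact: sub0mx.
  case yE: (opC y) => [i|? ? ? ?]; last exact: sub0mx.
  by rewrite -operand_coefs_emb; apply: predU; apply: preds_product.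
rewrite -embE operand_coefs_emb coefs_f.
move: nin predU; rewrite -embE /is_input preds_emb.
case: (op y) => // a u b v _ predU.
rewrite linearD !linearZ /= -!operand_coefs_emb addmx_sub // scalemx_sub //.
  by apply: predU; rewrite inE eqxx.
by apply: predU; rewrite !inE eqxx orbT.
Qed.

Lemma rank_operands_segment S1 S2 S3 :
  S = S1 ++ S2 ++ S3 ->
  (\rank (col_restrict F [set i in products S2]) <=
     #|cache (run S1 (initial G))| + size (reads S2))%N.
Proof.
move=> SE; have := sched_legal sched; rewrite SE !legal_cat => /and3P[_ leg2 _].
apply: (rank_computed_le_reads leg2 operand_coefs_combines) => i.
have [iS|iS] := boolP (i \in products S2); [right|left].
  have /productsP[y yi yS] := iS; exists (inC y) => //.
  by rewrite (operand_coefs_product yi); apply/rowP => j; rewrite !mxE inE iS.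
by apply/rowP => j; rewrite !mxE inE (negbTE iS).
Qed.

Hypothesis entries : one_vertex_per_source op.

(** Without reading entry [j], all computed vectors would stay in the hyperplane where the [j]-th
    coordinate vanishes; that of product [i] lies outside it. *)
Lemma entry_read j (x : V) :
  op x = Source j -> (exists i, F j i != 0) -> emb x \in reads S.
Proof.
move=> xj [i Fji]; apply: contraNT Fji => not_read.
pose U := kermx (delta_mx j 0 : 'cV[R]_d).
have coordU (u : 'rV[R]_d) : (u <= U)%MS = (u 0 j == 0).
  rewrite /U; apply/sub_kermxP/eqP => [/rowP/(_ 0)|u0].
    rewrite !mxE (bigD1 j) //= mxE !eqxx mulr1 big1 ?addr0 // => l ne_l.
    by rewrite mxE (negbTE ne_l) mulr0.
  apply/rowP => z; rewrite !mxE big1 // => l _; rewrite mxE.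
  by case: eqP => [->|]; rewrite ?u0 ?mul0r ?mulr0.
have [|y||comp_U _ _] := run_invariant
    (P := fun x => (operand_coefs x <= U)%MS) (sched_legal sched).
- by move=> y; rewrite inE.
(* An input that is read either lies outside the image of [emb], with zero vector, or carries an
   entry other than [j], whose only vertex is [x]. *)
- rewrite inE => y_in y_read; rewrite coordU /operand_coefs.
  case py: (proj y) (projK y) => [u|] /= embE; last first.
    by case: y y_in {y_read py embE} => [y _|y]; rewrite ?mxE // (negbTE (inC_not_input y)).
  have := coefs_f u; move: y_in; rewrite -embE /is_input preds_emb.
  case uE: (op u) => [l|? ? ? ?] // _ ->; rewrite !mxE andbT.
  case: (j =P l) => [jl|]; rewrite ?eqxx // -jl in uE *.
  have [x0 [_ x0_uniq]] := entries j.
  by move: not_read; rewrite -(x0_uniq _ xj) (x0_uniq _ uE) embE y_read.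
- by move=> y _ nin predU; apply: operand_coefs_combines.
have [y [yi _]] := products_once i.
have := comp_U (inC y); rewrite computed_schedule inC_not_input => /(_ isT).
by rewrite (operand_coefs_product yi) coordU !mxE.
Qed.

End Operands.
End Products.

(** * The bound for Phi *)

Lemma rho_neq0 (R : realType) (n : nat) (k : seq 'I_n) : rho R k != 0.
Proof.
rewrite /rho mulf_neq0 ?invr_eq0 ?pnatr_eq0 -?lt0n ?fact_gt0 // prodn_gt0 // => i.
exact: fact_gt0.
Qed.

(** The right-hand side is the rising product [n (n + 1) ... (n + d - 1)], with [d] factors at least
    [n]. *)
Lemma leq_exp_bin (n d : nat) : (0 < n)%N -> (n ^ d <= 'C(n + d - 1, d) * d`!)%N.
Proof.
case: n => // n _; rewrite bin_ffact addSn subn1 /=.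
elim: d => // d IHd; rewrite addnS ffactSS expnS leq_mul //.
by rewrite ltnS leq_addr.
Qed.

Lemma kappa_cases (s t v : nat) :
  [\/ kappa s t v = (s + v)%N, kappa s t v = (v + t)%N | kappa s t v = (s + t)%N].
Proof.
rewrite /kappa.
case: (leqP (s + v) (maxn (v + t) (s + t))) => _; last by constructor 1.
by case: (leqP (v + t) (s + t)) => _; [constructor 3|constructor 2].
Qed.

Lemma kappa_bounds (s t v : nat) :
  (0 < s + t + v)%N -> (0 < kappa s t v <= s + t + v)%N.
Proof. by rewrite /kappa; lia. Qed.

Section Schedules.
Variables (R : realType) (s t v n H : nat).
Variable G : circuit R #|incr_tuple n (s + v)| #|incr_tuple n (v + t)|
                       #|incr_tuple n (s + t)| #|incr_tuple n (s + t + v)|.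
Variable S : seq (instr (vertex G)).
Hypothesis dag : execution_dag (Phi R s t v n) G.
Hypothesis sched : schedule H S.

Let wA : (s + t + v = s + v + t)%N. Proof. lia. Qed.
Let wB : (s + t + v = v + t + s)%N. Proof. lia. Qed.

Definition projA (x : vertex G) : option (VA G) :=
  if x is inl (inl y) then Some y else None.
Definition projB (x : vertex G) : option (VB G) :=
  if x is inl (inr y) then Some y else None.

Let projAK : ocancel projA (@inA _ _ _ _ _ G). Proof. by case=> [[]|]. Qed.
Let projBK : ocancel projB (@inB _ _ _ _ _ G). Proof. by case=> [[]|]. Qed.
Let inAK : pcancel (@inA _ _ _ _ _ G) projA. Proof. by []. Qed.
Let inBK : pcancel (@inB _ _ _ _ _ G) projB. Proof. by []. Qed.

Let predsA (y : VC G) i : opC y = Source i -> inA (opndA G i) \in preds (inC y).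
Proof. by move=> yi; rewrite /= yi inE eqxx. Qed.
Let predsB (y : VC G) i : opC y = Source i -> inB (opndB G i) \in preds (inC y).
Proof. by move=> yi; rewrite /= yi !inE eqxx orbT. Qed.

Let gA_neq0 (a : t.-tuple 'I_n) : t`!%:R / rho R a != 0.
Proof. by rewrite mulf_neq0 ?invr_eq0 ?rho_neq0 // pnatr_eq0 -lt0n fact_gt0. Qed.
Let gB_neq0 (b : s.-tuple 'I_n) : s`!%:R / rho R b != 0.
Proof. by rewrite mulf_neq0 ?invr_eq0 ?rho_neq0 // pnatr_eq0 -lt0n fact_gt0. Qed.
Let gC_neq0 (c : v.-tuple 'I_n) : s`!%:R * t`!%:R * rho R c != 0.
Proof. by rewrite mulf_neq0 ?rho_neq0 // mulf_neq0 // pnatr_eq0 -lt0n fact_gt0. Qed.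

(** The cache adds at most [H] to the reads of a segment, and nothing to those of an initial one. *)
Lemma cost_ge_operands (d k : nat) (F : 'M[R]_(d, #|incr_tuple n (s + t + v)|))
    (c w : nat) (E : R) :
  (0 < k <= w)%N -> (0 < c)%N -> (0 < H)%N -> 0 < E ->
  E ^+ k = (3 * c%:R * H%:R) ^+ w ->
  (forall W : {set 'I_#|incr_tuple n (s + t + v)|},
     #|W| ^ k <= (c * \rank (col_restrict F W)) ^ w)%N ->
  (forall S1 S2 S3, S = S1 ++ S2 ++ S3 ->
     (\rank (col_restrict F [set i in products S2]) <=
        #|cache (run S1 (initial G))| + size (reads S2))%N) ->
  2 * H%:R / E * #|incr_tuple n (s + t + v)|%:R <= (comm_cost S)%:R.
Proof.
move=> le_kw c_gt0 H_gt0 E_gt0 Ek expand rank_le.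
have /andP[_ le_kw'] := le_kw.
have w_gt0 : (0 < w)%N by apply: leq_trans le_kw'; case/andP: le_kw.
have reads_le S' : (size (reads S') <= comm_cost S')%N.
  by rewrite comm_cost_reads_writes leq_addr.
apply: (cost_from_segments (dag_products dag) sched le_kw c_gt0 H_gt0 E_gt0 Ek).
  move=> S1 S2 S3 SE; apply: leq_trans (expand _) _.
  rewrite leq_exp2r // leq_mul2l; apply/orP; right.
  apply: leq_trans (rank_le _ _ _ SE) _; rewrite leq_add ?reads_le //.
  have := sched_legal sched; rewrite SE legal_cat => /andP[leg1 _].
  by apply: card_cache_run leg1 _; rewrite cards0.
left=> S1 S2 SE; apply: leq_trans (expand _) _.
rewrite leq_exp2r // leq_mul2l; apply/orP; right.
apply: leq_trans (rank_le [::] S1 S2 SE) _.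
by rewrite /= cards0 add0n reads_le.
Qed.

(** The matrix used is one whose rows are indexed by tuples of length [kappa]. *)
Lemma cost_ge_products (H_gt0 : (0 < H)%N) (stv_gt0 : (0 < s + t + v)%N) (E : R) :
  0 < E ->
  E ^+ kappa s t v =
    (3 * 'C(s + t + v, kappa s t v)%:R * H%:R) ^+ (s + t + v) ->
  2 * H%:R / E * #|incr_tuple n (s + t + v)|%:R <= (comm_cost S)%:R.
Proof.
move=> E_gt0 Ek; have le_kw := kappa_bounds stv_gt0.
have c_gt0 : (0 < 'C(s + t + v, kappa s t v))%N.
  by rewrite bin_gt0; case/andP: le_kw.
have [fA cA oA] := dag_opndA dag.
have [fB cB oB] := dag_opndB dag.
have [fC cC oC] := dag_out dag.
have [] := kappa_cases s t v => kE; rewrite kE in le_kw c_gt0 Ek.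
- apply: (cost_ge_operands le_kw c_gt0 H_gt0 E_gt0 Ek) => [W|S1 S2 S3].
    by apply: (chi_expansion _ wA _ gA_neq0); case/andP: le_kw.
  exact: (rank_operands_segment sched inAK projAK (fun=> erefl) (fun=> erefl)
            predsA cA oA).
- apply: (cost_ge_operands le_kw c_gt0 H_gt0 E_gt0 Ek) => [W|S1 S2 S3].
    by apply: (chi_expansion _ wB _ gB_neq0); case/andP: le_kw.
  exact: (rank_operands_segment sched inBK projBK (fun=> erefl) (fun=> erefl)
            predsB cB oB).
(* In the remaining case, [kappa = s + t], the cache at the end of a segment counts. The incomplete
   segment is put last, where [L] can be empty. *)
have k_gt0 : (0 < s + t)%N by case/andP: le_kw.
have expand W := chi_expansion W (erefl (s + t + v)%N) k_gt0 gC_neq0.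
have writes_le S' : (size (writes S') <= comm_cost S')%N.
  by rewrite comm_cost_reads_writes leq_addl.
apply: (cost_from_segments (dag_products dag) sched le_kw c_gt0 H_gt0 E_gt0 Ek).
  move=> S1 S2 S3 SE; apply: leq_trans (expand _) _.
  rewrite leq_exp2r // leq_mul2l; apply/orP; right.
  pose L := enum (cache (run (S1 ++ S2) (initial G))).
  have cacheL : {subset cache (run (S1 ++ S2) (initial G)) <= L}.
    by move=> x xc; rewrite mem_enum.
  apply: leq_trans (rank_outputs_segment (dag_products dag) sched cC oC SE
                      (or_intror cacheL)) _.
  rewrite leq_add ?writes_le // -cardE.
  have := sched_legal sched; rewrite SE catA legal_cat => /andP[leg12 _].
  by apply: card_cache_run leg12 _; rewrite cards0.
right=> S1 S2 SE; apply: leq_trans (expand _) _.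
rewrite leq_exp2r // leq_mul2l; apply/orP; right.
apply: leq_trans (rank_outputs_segment (S1 := S1) (S2 := S2) (L := [::])
  (dag_products dag) sched cC oC _ (or_introl erefl)) _; first by rewrite cats0.
exact: writes_le.
Qed.

Lemma cost_ge_inputs_outputs : (0 < n)%N ->
  (#|incr_tuple n (s + v)| + #|incr_tuple n (v + t)| + #|incr_tuple n (s + t)|
     <= comm_cost S)%N.
Proof.
move=> n_gt0.
have [fA cA oA] := dag_opndA dag.
have [fB cB oB] := dag_opndB dag.
have [fC cC oC] := dag_out dag.
rewrite comm_cost_reads_writes leq_add //; last first.
  (* Outputs sharing a vertex would have equal rows in [matC], which [chi_rows_neq] excludes. *)
  apply: (outputs_written sched) => h h' out_eq; apply/enum_val_inj/eqP.
  apply: contraT => /(chi_rows_neq (erefl (s + t + v)%N) gC_neq0)[i].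
  have /rowP/(_ (enum_rank i)) :
      row h (matC (Phi R s t v n)) = row h' (matC (Phi R s t v n)).
    by apply: (can_inj (@trmxK _ _ _)); rewrite -!oC out_eq.
  by rewrite !mxE enum_rankK => -> /eqP.
have /fin_all_exists[srcA srcAP] : forall j, exists x : VA G, opA x = Source j.
  by move=> j; have [x []] := dag_entriesA dag j; exists x.
have /fin_all_exists[srcB srcBP] : forall j, exists x : VB G, opB x = Source j.
  by move=> j; have [x []] := dag_entriesB dag j; exists x.
have srcA_inj : injective srcA.
  by move=> j j' e; have := srcAP j; rewrite e srcAP => -[].
have srcB_inj : injective srcB.
  by move=> j j' e; have := srcBP j; rewrite e srcBP => -[].
pose inputs : seq (vertex G) :=
  [seq inA (srcA j) | j <- enum 'I_#|incr_tuple n (s + v)|] ++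
  [seq inB (srcB j) | j <- enum 'I_#|incr_tuple n (v + t)|].
apply: leq_trans (_ : size inputs <= _)%N.
  by rewrite size_cat size_map size_map -!cardE !card_ord.
apply: uniq_leq_size => [|x].
  have injA : injective (fun j => inA (srcA j)) by move=> j j' [/srcA_inj].
  have injB : injective (fun j => inB (srcB j)) by move=> j j' [/srcB_inj].
  rewrite cat_uniq (map_inj_uniq injA) (map_inj_uniq injB) !enum_uniq andbT /=.
  by apply/hasPn => x /mapP[j _ ->]; apply/mapP => -[].
rewrite mem_cat => /orP[] /mapP[j _ ->].
- apply: (entry_read (dag_products dag) sched inAK projAK (fun=> erefl) (fun=> erefl)
            predsA cA oA (dag_entriesA dag) (srcAP j)).
  have [i ne0] := chi_row_neq0 (enum_val j) n_gt0 wA gA_neq0.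
  by exists (enum_rank i); rewrite mxE enum_rankK.
- apply: (entry_read (dag_products dag) sched inBK projBK (fun=> erefl) (fun=> erefl)
            predsB cB oB (dag_entriesB dag) (srcBP j)).
  have [i ne0] := chi_row_neq0 (enum_val j) n_gt0 wB gB_neq0.
  by exists (enum_rank i); rewrite mxE enum_rankK.
Qed.

End Schedules.

(** By [leq_exp_bin], each term of the maximum is at least twice its constant times the
    corresponding power term; the factor 2 is spent on bounding a maximum below by the mean. *)
Lemma comm_bound_asymptotics (R : realType) (s t v n H : nat) :
  (0 < s + t + v)%N -> (0 < n)%N -> (0 < H)%N ->
  Num.min (((3 * 'C(s + t + v, kappa s t v)%:R)
              `^ ((s + t + v)%:R / (kappa s t v)%:R))^-1 / (s + t + v)`!%:R)
          (2 * (kappa s t v)`!%:R)^-1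
    * (n%:R ^+ (s + t + v)
         / (H%:R `^ ((s + t + v)%:R / (kappa s t v)%:R - 1))
       + n%:R ^+ kappa s t v)
  <= comm_bound R n s t v H.
Proof.
move=> stv_gt0 n_gt0 H_gt0; rewrite /comm_bound.
set w := (s + t + v)%N; set k := kappa s t v.
have /andP[k_gt0 le_kw] : (0 < k <= w)%N := kappa_bounds stv_gt0.
have H_gt0' : 0 < H%:R :> R by rewrite ltr0n.
have C_gt0 : 0 < 'C(w, k)%:R :> R by rewrite ltr0n bin_gt0.
have k_gt0' : 0 < k%:R :> R by rewrite ltr0n.
have w_gt0' : 0 < w%:R :> R by rewrite ltr0n.
set X := (X in Num.max X _); set Y := (Y in Num.max _ Y).
set th := w%:R / k%:R.
have th_gt0 : 0 < th by rewrite divr_gt0.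
set c0 := (_ / w`!%:R); set c1 := (2 * _)^-1.
have fact_gt0' j : 0 < j`!%:R :> R by rewrite ltr0n fact_gt0.
have bin_ge j : n%:R ^+ j <= 'C(n + j - 1, j)%:R * j`!%:R :> R.
  by rewrite -natrX -natrM ler_nat leq_exp_bin.
have X_ge : 2 * (c0 * (n%:R ^+ w / H%:R `^ (th - 1))) <= X.
  (* The factor [H] of the numerator cancels through [H ^ th = H * H ^ (th - 1)]. *)
  have -> : X = 2 * ('C(n + w - 1, w)%:R / ((3 * 'C(w, k)%:R) `^ th * H%:R `^ (th - 1))).
    rewrite /X powRM ?mulr_ge0 ?(ltW C_gt0) ?(ltW H_gt0') //.
    rewrite -(mulr_powRB1 (ltW H_gt0') th_gt0).
    by field; rewrite !gt_eqF ?powR_gt0 ?mulr_gt0.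
  rewrite ler_pM2l // /c0.
  set A := _ `^ th; set B := _ `^ _.
  have A_gt0 : 0 < A by rewrite powR_gt0 ?mulr_gt0.
  have B_gt0 : 0 < B by rewrite powR_gt0.
  have -> : A^-1 / w`!%:R * (n%:R ^+ w / B) = (n%:R ^+ w / w`!%:R) / (A * B).
    by field; rewrite !gt_eqF.
  by rewrite ler_wpM2r ?invr_ge0 ?mulr_ge0 ?(ltW A_gt0) ?(ltW B_gt0) // ler_pdivrMr.
have Y_ge : 2 * (c1 * n%:R ^+ k) <= Y.
  apply: (@le_trans _ _ 'C(n + k - 1, k)%:R).
    have -> : 2 * (c1 * n%:R ^+ k) = n%:R ^+ k / k`!%:R by rewrite /c1; field; rewrite gt_eqF.
    by rewrite ler_pdivrMr.
  (* Whichever sum realises [kappa], its binomial is one of the three terms of [Y]. *)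
  rewrite /Y -!natrD ler_nat /k.
  by have [->|->|->] := kappa_cases s t v; rewrite !addnA; lia.
have a_ge0 : 0 <= n%:R ^+ w / H%:R `^ (th - 1) :> R.
  by rewrite divr_ge0 ?exprn_ge0 ?powR_ge0.
have b_ge0 : 0 <= n%:R ^+ k :> R by rewrite exprn_ge0.
rewrite mulrDr.
have le_a : Num.min c0 c1 * (n%:R ^+ w / H%:R `^ (th - 1)) <=
            c0 * (n%:R ^+ w / H%:R `^ (th - 1)).
  by rewrite ler_wpM2r // ge_min lexx.
have le_b : Num.min c0 c1 * n%:R ^+ k <= c1 * n%:R ^+ k.
  by rewrite ler_wpM2r // ge_min lexx orbT.
have le_X : X <= Num.max X Y by rewrite le_max lexx.
have le_Y : Y <= Num.max X Y by rewrite le_max lexx orbT.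
lra.
Qed.

Theorem theorem6p4 (R : realType) (s t v : nat) (stv_gt0 : (0 < s + t + v)%N) :
  (exists N : nat, forall n H : nat, (N <= n)%N -> (1 <= H)%N ->
     forall G : circuit R #|incr_tuple n (s + v)| #|incr_tuple n (v + t)|
                  #|incr_tuple n (s + t)| #|incr_tuple n (s + t + v)|,
     execution_dag (Phi R s t v n) G ->
     forall S : seq (instr (vertex G)), schedule H S ->
       comm_bound R n s t v H <= (comm_cost S)%:R) /\
  (exists c : R, exists N : nat, 0 < c /\
     forall n H : nat, (N <= n)%N -> (1 <= H)%N ->
       c * (n%:R ^+ (s + t + v)
              / (H%:R `^ ((s + t + v)%:R / (kappa s t v)%:R - 1))
            + n%:R ^+ kappa s t v)
         <= comm_bound R n s t v H).
Proof.
split.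
  (* Every [n >= 1] is large enough: positivity serves the cardinality formula and the padding of
     tuples. *)
  exists 1%N => n H n_gt0 H_gt0 G dag S sched.
  have /andP[k_gt0 le_kw] := kappa_bounds stv_gt0.
  rewrite /comm_bound ge_max; apply/andP; split.
    set E := _ `^ _.
    have base_gt0 : 0 < 3 * 'C(s + t + v, kappa s t v)%:R * H%:R :> R.
      by rewrite !mulr_gt0 // ltr0n // bin_gt0.
    have E_gt0 : 0 < E := powR_gt0 _ base_gt0.
    have -> : 2 * 'C(n + (s + t + v) - 1, s + t + v)%:R * H%:R / E =
              2 * H%:R / E * #|incr_tuple n (s + t + v)|%:R.
      by rewrite card_incr_tuple //; ring.
    apply: (cost_ge_products dag sched H_gt0 stv_gt0 E_gt0).
    rewrite -powR_mulrn ?powR_ge0 // -powRrM divfK.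
      by rewrite powR_mulrn // ltW.
    by rewrite pnatr_eq0 -lt0n.
  rewrite -!natrD ler_nat.
  apply: leq_trans (cost_ge_inputs_outputs dag sched n_gt0).
  by rewrite !card_incr_tuple // !addnA.
exists (Num.min (((3 * 'C(s + t + v, kappa s t v)%:R)
                   `^ ((s + t + v)%:R / (kappa s t v)%:R))^-1 / (s + t + v)`!%:R)
                (2 * (kappa s t v)`!%:R)^-1), 1%N.
split=> [|n H n_gt0 H_gt0]; last exact: comm_bound_asymptotics.
have /andP[_ le_kw] := kappa_bounds stv_gt0.
rewrite lt_min invr_gt0 mulr_gt0 ?divr_gt0 ?invr_gt0 ?powR_gt0 //.
all: by rewrite ?mulr_gt0 ?ltr0n ?bin_gt0 ?fact_gt0.
Qed.
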